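(* Let $\mathcal{S}=\lim_{n\to\infty}\frac{1}{n}\log s_n$ be the entropy of ternary square-free words, and let $x_c^{(24)}$ be the radius of convergence of the generating function $S^{(24)}(x)=\sum_{n\ge0}s_n^{(24)}x^n$ of ternary length-$24$ square-free words. Then $\mathcal{S}\le -\log\big(x_c^{(24)}\big)$, where $x_c^{(24)}\approx 0.768085659$; consequently $\exp(\mathcal{S})\le 1/x_c^{(24)}<1.3019382$.
   Context: Words are finite strings over the alphabet $\{a,b,c\}$; $\lambda$ denotes the empty word. A word $w$ is square-free if whenever $w=xyyz$ for words $x,y,z$, then $y=\lambda$. $s_n$ denotes the number of ternary square-free words of length $n$; the limit $\mathcal{S}=\lim_{n\to\infty}\frac1n\log s_n$ exists. For an integer $\ell\ge0$, a word $w$ is length-$\ell$ square-free if whenever $w=xyyz$ with $y$ of length at most $\ell$, then $y=\lambda$ (i.e. $w$ contains no square of a nonempty word of length $\le \ell$). $s_n^{(\ell)}$ denotes the number of ternary length-$\ell$ square-free words of length $n$; $S^{(\ell)}(x)=\sum_n s_n^{(\ell)}x^n$ is a rational function, and $x_c^{(\ell)}$ denotes its radius of convergence. *)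

(* Defs.v *)
From Stdlib Require Import Reals.
From Coquelicot Require Import Coquelicot.
From mathcomp Require Import all_boot.
From mathcomp Require Import boolp.

(* The letters a, b, c are 0, 1, 2 : 'I_3. *)
Definition word := seq 'I_3.

Definition square_free (w : word) : Prop :=
  forall x y z : word, w = x ++ y ++ y ++ z -> y = [::].

Definition length_square_free (l : nat) (w : word) : Prop :=
  forall x y z : word, w = x ++ y ++ y ++ z -> (size y <= l)%N -> y = [::].

Definition nb_square_free (n : nat) : nat :=
  #|[set w : n.-tuple 'I_3 | `[< square_free w >]]|.

Definition nb_length_square_free (l n : nat) : nat :=
  #|[set w : n.-tuple 'I_3 | `[< length_square_free l w >]]|.

Definition entropy_seq (n : nat) : R :=
  (ln (INR (nb_square_free n)) / INR n)%R.

(* [real] and [Lim_seq] are total, so this is the limit only when the sequence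
   converges to a finite value. *)
Definition entropy : R := real (Lim_seq entropy_seq).

(* [real] sends an infinite radius to 0. *)
Definition radius (l : nat) : R :=
  real (CV_radius (fun n => INR (nb_length_square_free l n))).

(* Main.v *)
(* A word without repeated letter is determined, up to renaming of the letters, by
   its Pansiot code, the binary word whose bits tell whether the letters at
   distance two differ.  Words grow at their head.  Give a word w the weight W(w)
   attached to the longest prefix of its code that occurs in a minimal square of
   period at most 24; codes that start with such a square get weight 0.  This is
   a finite transfer matrix, with 11842 states up to renaming, and if W is close
   to its Perron eigenvector then W(0w) + W(1w) is close to W(w) / x_c for all w.
   Two integral weights, checked by computation, turn this into inequalities,
   valid when W(w) > 0,

     12886339 / 2^24 * (W(0w) + W(1w)) <= W(w),
     W(w) <= 52782444609 / 2^36 * (W(0w) + W(1w)),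

   and summing them over all words of a given length encloses the radius of
   convergence between the two fractions.  The first one needs that weight 0
   implies a short square at the head of w, the second one that words all of whose
   suffixes have positive weight avoid short squares.  The limit defining the
   entropy exists by Fekete's lemma (if square-free words were to run out, [ln 0]
   is 0 and so is the limit). *)

Require Import Defs.
From Stdlib Require Import Reals NArith ZArith Lia Lra.
From Coquelicot Require Import Coquelicot.
From mathcomp Require Import all_boot.
From mathcomp Require Import boolp.

Set Implicit Arguments.
Unset Strict Implicit.
Unset Printing Implicit Defensive.

(* MathComp takes over the key R. *)
Delimit Scope R_scope with R.
Local Open Scope nat_scope.

(** * Pansiot codes *)

Fixpoint code (T : eqType) (w : seq T) : seq bool :=
  if w is a :: ((b :: (c :: _)) as w') then (a != c) :: code w' else [::].

(* Over the letters 0, 1, 2 the letter other than p <> q is 3 - p - q. *)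
Fixpoint decode (p q : nat) (c : seq bool) : seq nat :=
  p :: (if c is b :: c' then decode q (if b then 3 - p - q else p) c'
        else [:: q]).

Fixpoint adjacent_distinct (T : eqType) (w : seq T) : bool :=
  if w is a :: ((b :: _) as w') then (a != b) && adjacent_distinct w' else true.

(** * Context trees *)

Inductive tree := Leaf | Node (v : N) (l r : tree).

(* A node of weight 0 marks the codes of words that start with a square; its
   subtrees are ignored. *)
Definition child (b : bool) (t : tree) : tree :=
  if t is Node (Npos _) l r then if b then r else l else Leaf.

Definition top (d : N) (t : tree) : N := if t is Node v _ _ then v else d.

Fixpoint walk (t : tree) (d : N) (c : seq bool) : N :=
  if c is b :: c' then walk (child b t) (top d t) c' else top d t.

Definition isz (x : N) : bool := if x is N0 then true else false.

Fixpoint has_dead_suffix (t : tree) (c : seq bool) : bool :=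
  isz (walk t 0 c) || (if c is _ :: c' then has_dead_suffix t c' else false).

(* With t, s0, s1 the subtrees reached by the codes c, 0c, 1c, tests [rel] on
   the weights of all the continuations of these codes; [d0] and [d1] are
   inherited from the parents of s0 and s1. *)
Fixpoint check_rel (rel : N -> N -> N -> bool) (t s0 s1 : tree) (d0 d1 : N)
    : bool :=
  if t is Node v l r then
    if v is N0 then true else
    let e0 := top d0 s0 in
    let e1 := top d1 s1 in
    if rel v e0 e1 then
      if check_rel rel l (child false s0) (child false s1) e0 e1 then
        check_rel rel r (child true s0) (child true s1) e0 e1
      else false
    else false
  else match s0, s1 with Leaf, Leaf => true | _, _ => false end.

Definition check_step rel t :=
  check_rel rel t (child false t) (child true t) (top 0 t) (top 0 t).

Definition half_square (l : nat) (w : seq nat) : bool :=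
  let h := (size w)./2 in (0 < h <= l) && (take h w == drop h w).

Fixpoint check_dead (l : nat) (t : tree) (s : seq bool) : bool :=
  if t is Node v t0 t1 then
    if v is N0 then half_square l (decode 0 1 (rev s))
    else check_dead l t0 (false :: s) && check_dead l t1 (true :: s)
  else true.

(** If [y] ends in its first letter, 0, then yy repeats a letter at the junction, and its code need
    not be examined. *)
Definition square_dead (t : tree) (c : seq bool) : bool :=
  let y := decode 0 1 c in
  (last 0 y == 0) || has_dead_suffix t (code (y ++ y)).

(** Dropping an extension of weight 0 loses nothing: every longer code built on it has it as a dead
    suffix. *)
Fixpoint check_squares (t : tree) (n : nat) (c : seq bool) : bool :=
  square_dead t c &&
  (if n is n'.+1 then
     let ext c := if isz (walk t 0 c) then true else check_squares t n' c in
     ext (false :: c) && ext (true :: c)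
   else true).

(** * Construction of the trees *)

Fixpoint same_take (k : nat) (w t : seq nat) : bool :=
  if k is k'.+1 then
    match w, t with
    | a :: w', b :: t' => if Nat.eqb a b then same_take k' w' t' else false
    | _, _ => false
    end
  else true.

Fixpoint starts_with_square_at (t w : seq nat) (k : nat) : bool :=
  if t is _ :: t' then
    if same_take k w t then true else starts_with_square_at t' w k.+1
  else false.

Definition starts_with_square w := starts_with_square_at (behead w) w 1.

(** Meant for [u = rev y] and [w = y]: tests the suffixes of yy longer than y, stopping one letter
    short because yy itself starts with a square. *)
Fixpoint minimal_square (u w : seq nat) : bool :=
  match u with
  | [::] | [:: _] => true
  | a :: u' =>
      if starts_with_square (a :: w) then false else minimal_square u' (a :: w)
  end.

(* Collects the extensions y of the square-free word abw by at most n letters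
   such that yy has no shorter square. *)
Fixpoint enum_roots (n a b : nat) (w : seq nat) (acc : seq (seq nat))
    : seq (seq nat) :=
  let y := a :: b :: w in
  let acc := if minimal_square (rev y) y then y :: acc else acc in
  if n is n'.+1 then
    let ext x acc :=
      if starts_with_square (x :: y) then acc
      else enum_roots n' x a (b :: w) acc in
    ext b (ext (3 - a - b) acc)
  else acc.

Fixpoint mark (c : seq bool) (t : tree) : tree :=
  let: (l, r) := if t is Node _ l r then (l, r) else (Leaf, Leaf) in
  match c with
  | [::] => Node 0 Leaf Leaf
  | b :: c' => if b then Node 1 l (mark c' r) else Node 1 (mark c' l) r
  end.

Definition squares (n : nat) : tree :=
  foldr (fun y => mark (code (y ++ y))) Leaf (enum_roots n.-2 0 1 [::] [::]).

Fixpoint put (c : seq bool) (v : N) (t : tree) : tree :=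
  let: (u, l, r) := if t is Node u l r then (u, l, r) else (1%num, Leaf, Leaf)
  in match c with
     | [::] => Node v l r
     | b :: c' => if b then Node u l (put c' v r) else Node u (put c' v l) r
     end.

(* Solves v(s) = f (v(0s) + v(1s)) along the tree [sq] of squares. As its set of
   codes is closed under reversal, [sq] can be traversed from the oldest letter
   to the newest one, which is the head of [s]. When 0s or 1s leaves [sq], its
   weight is read off [seeds]. *)
Fixpoint fill (f : N -> N) (e : N) (seeds sq t : tree) (s : seq bool)
    (acc : tree) : N * tree :=
  match t with
  | Leaf => (if isz (walk sq 1 s) then 0 else walk seeds 0 s + e, acc)%num
  | Node v l r =>
      if v is N0 then (N0, put s N0 acc) else
      let: (x, acc) := fill f e seeds sq l (false :: s) acc in
      let: (y, acc) := fill f e seeds sq r (true :: s) acc in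
      let v := f (x + y)%num in (v, put s v acc)
  end.

(** The leading 1 is a sentinel that fixes the length of the code; the lowest bit is the newest. *)
Fixpoint bits (p : positive) : seq bool :=
  match p with
  | xH => [::]
  | xO p => false :: bits p
  | xI p => true :: bits p
  end.

(* Approximate right eigenvector of the transfer matrix (found by power
   iteration) at the 193 states entered by a transition that does not extend the
   current longest factor of a minimal square. *)
Definition seed_weights : seq (N * N) :=
  [:: (951, 78855372366); (950, 0); (15290, 75261338449); (14199, 0); (30171,
   54837842053); (28118, 92137094860); (56763, 101335118269); (56762,
   72430108647); (121559, 62856469083); (120502, 43465006651); (243158,
   54621728790); (244438, 93571884486); (244439, 47040532179); (241014,
   74672336880); (241015, 60557996936); (241114, 51806247835); (241339,
   101268590417); (241334, 43255937738); (224983, 72960101583); (224954,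
   70484024469); (226775, 76844005207); (226779, 49800664488); (486234,
   66519598379); (486262, 35437638707); (486263, 60727909132); (486330,
   74359191791); (486331, 59417730676); (488923, 35269443365); (488890,
   74335054893); (488891, 96722262493); (489146, 58894348603); (489147,
   102417782048); (489142, 43390338786); (489143, 55085334858); (482235,
   59708626520); (482138, 70213107885); (482779, 60191432045); (448346, 0);
   (448347, 92645853604); (448214, 89472636769); (448182, 43465006651);
   (448186, 34942201621); (450007, 73982646194); (450010, 71766944362);
   (450011, 60058915017); (449911, 60458356811); (454006, 73268716108);
   (454007, 60447105407); (454330, 69916521833); (454331, 94689049604);
   (454326, 41940391822); (454327, 77340265993); (454359, 72525433545);
   (453495, 60346453227); (453494, 65888156120); (453467, 90343003141);
   (453563, 59120318773); (453562, 74662633478); (972470, 43465006651);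
   (972503, 73278777214); (978395, 60124920488); (964054, 0); (964055,
   77111880670); (964027, 88796410956); (964442, 63596374932); (964278,
   38807379796); (964282, 59643482824); (965334, 93482310963); (965335, 0);
   (896727, 72764330581); (896699, 100752737344); (896698, 69724494299);
   (896474, 33060879305); (896475, 60068316819); (899959, 60380557533);
   (899930, 70120612252); (899931, 33327496982); (907991, 62810270343);
   (906967, 72756486087); (906939, 103810971712); (906938, 0); (907099,
   92143260816); (907098, 42360239814); (1945046, 90768000554); (1945047,
   74742238902); (1945303, 71716658895); (1945302, 85807170551); (1955543,
   72756486087); (1955542, 89314478044); (1956794, 74410855006); (1956795,
   59637111694); (1928027, 90172140477); (1928026, 60075399337); (1928887,
   74992137551); (1928886, 43267884518); (1928890, 70403438196); (1928567,
   59303661591); (1928566, 74307546631); (1930711, 74909278550); (1930710,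
   79187297767); (1930682, 74263157493); (1930683, 96465186573); (1930939,
   101065867230); (1930938, 59513435633); (1930934, 43425062867); (1930935,
   55036419069); (1931099, 90527163578); (1931098, 63574661791); (1793495,
   74320846060); (1793494, 89778061796); (1793499, 59827289316); (1793498,
   71298190620); (1792955, 59660249600); (1792954, 74356585777); (1792726,
   84163128474); (1792727, 62635043778); (1800027, 91128433377); (1800026,
   63595587976); (1799642, 71704972528); (1799643, 35269443365); (1816022,
   54586886518); (1816023, 76886471709); (1815995, 46644236135); (1815994,
   74920335390); (1817435, 75637752734); (1817434, 70086212905); (1817462,
   70217547657); (1817463, 60640419611); (1813975, 74786551641); (1813974,
   89259089922); (1814231, 72682922928); (3890551, 59542004549); (3890550,
   71631824958); (3911382, 85710904129); (3911383, 72682922928); (3911351,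
   75581261587); (3911350, 43255937738); (3856058, 34629816539); (3856059,
   103675905867); (3857879, 73106469719); (3857878, 91155878337); (3857782,
   63073166558); (3857783, 60410735923); (3862231, 71642172283); (3862230,
   85867395320); (3586906, 69897172334); (3586907, 75549660300); (3585723,
   102307894420); (3585722, 59643482824); (3585883, 90468650006); (3585882,
   63596374932); (3585466, 74660172280); (3599835, 59888842015); (3599834,
   60180195796); (3631962, 66431336546); (3627866, 69967769551); (3627867,
   81424099642); (3627735, 62404665912); (3627734, 88511769349); (7779770,
   74660172280); (7779771, 88589522362); (7780022, 38807379796); (7780023,
   67231375284); (7822807, 73283911629); (7822806, 90818296018); (7826266,
   66223679229); (7826267, 89727410176); (7827159, 71971063164); (7827158,
   60964991096); (7712214, 90666486260); (7712215, 74685706209); (7715703,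
   59898939639); (7715702, 70772593478); (7714234, 74732804644); (7714235,
   73768990350); (7723734, 91972177072); (7723735, 62782124711); (7724407,
   59698034722); (7724406, 63079357506); (7171770, 70184133664); (7171771,
   94760098235); (7170935, 60538270502); (7170934, 54907418014); (7171003,
   59183066738); (7171002, 74286876363); (7263926, 42981695382); (7263927,
   73914244252); (7263959, 73071952275); (7263958, 89367745318); (7269210,
   68111472088); (7269211, 90228721437); (7256923, 75366900749); (7256922,
   70050727672)]%num.

Definition seed_tree : tree :=
  foldr (fun '(p, v) => put (if p is Npos q then bits q else [::]) v)
    Leaf seed_weights.

(* The dyadic fractions K / 2^k that govern the two trees, and that recur in the
   checks, enclose the radius of convergence. *)
Definition lower_tree : tree :=
  let sq := squares 24 in
  (fill (fun s => N.shiftr (52782444609 * s) 36) 0 seed_tree sq sq [::] Leaf).2.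

(** Adding 2 rounds up, which reverses the inequality of [lower_tree]. It also gives a code with
    only dead extensions weight 2 instead of 0, so that weight 0 is left to squares. The 64 added to
    the seeds is slack for these roundings. *)
Definition upper_tree : tree :=
  let sq := squares 24 in
  (fill (fun s => N.shiftr (12886339 * s) 24 + 2) 64 seed_tree sq sq
     [::] Leaf)%num.2.

Definition lower_rel (K k v a b : N) : bool :=
  N.leb (N.shiftl v k) (K * (a + b)).

Definition upper_rel (K k v a b : N) : bool :=
  N.leb (K * (a + b)) (N.shiftl v k).

Definition check_lower (l : nat) (K k : N) (t : tree) : bool :=
  [&& ~~ isz (top 0 t), check_step (lower_rel K k) t
    & check_squares t l.-2 [::]].

Definition check_upper (l : nat) (K k : N) (t : tree) : bool :=
  [&& ~~ isz (top 0 t), check_step (upper_rel K k) t & check_dead l t [::]].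

Lemma lower_tree_checked : check_lower 24 52782444609 36 lower_tree.
Proof. by vm_compute. Qed.

Lemma upper_tree_checked : check_upper 24 12886339 24 upper_tree.
Proof. by vm_compute. Qed.

(** * Codes and squares *)

Lemma code_map (T U : eqType) (f : T -> U) (w : seq T) :
  injective f -> code (map f w) = code w.
Proof.
move=> inj_f; elim: w => [//|a [//|b [//|c w]] IH].
by rewrite /= (inj_eq inj_f); congr (_ :: _); apply: IH.
Qed.

Lemma code_cat (T : eqType) (u v : seq T) :
  exists r, code (u ++ v) = code u ++ r.
Proof.
elim: u => [|a u [r IH]]; first by exists (code v).
case: u IH => [|b [|c u]] IH; [by eexists|by eexists|].
by exists r; rewrite /= in IH *; rewrite IH.
Qed.

Lemma decode_cat p q c1 c2 :
  exists z, decode p q (c1 ++ c2) = decode p q c1 ++ z.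
Proof.
elim: c1 p q => [|b c IH] p q /=; last first.
  by have [z ->] := IH q (if b then 3 - p - q else p); exists z.
case: c2 => [|b c2]; first by exists [::].
by case: c2 => [|b' c2]; eexists.
Qed.

Definition rename (a b x : 'I_3) : nat :=
  if x == a then 0 else if x == b then 1 else 2.

Lemma rename_inj (a b : 'I_3) : a != b -> injective (rename a b).
Proof.
move=> ab x y; rewrite /rename.
case: (eqVneq x a) => [->|xa]; case: (eqVneq y a) => [->|ya] //.
- by case: ifP.
- by case: ifP.
case: (eqVneq x b) => [->|xb]; case: (eqVneq y b) => [->|yb] // _.
apply/val_inj; move: a b x y ab xa ya xb yb.
do 4![case; case=> [|[|[|?]]] //= ?].
Qed.

Lemma rename_third (a b x y z : 'I_3) : a != b -> x != y -> z != y -> z != x ->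
  rename a b z = 3 - rename a b x - rename a b y.
Proof.
rewrite /rename; move: a b x y z.
by do 5![case; case=> [|[|[|?]]] //= ?].
Qed.

(** The renaming stays fixed while [x], [y] move along the word, so the induction needs them
    independent of [a], [b]. *)
Lemma decode_code (a b x y : 'I_3) (w : seq 'I_3) : a != b ->
  adjacent_distinct (x :: y :: w) ->
  decode (rename a b x) (rename a b y) (code (x :: y :: w))
    = map (rename a b) (x :: y :: w).
Proof.
move=> ab; elim: w x y => [//|z w IH] x y /= /andP[xy /andP[yz adj]].
have {}IH := IH y z; rewrite /= yz /= in IH.
congr (_ :: _); rewrite -(IH adj); congr (decode _ _ _).
case: (eqVneq x z) => [->//|xz] /=.
by rewrite -(@rename_third a b x y z) // eq_sym.
Qed.

Lemma decode_code01 (a b : 'I_3) (w : seq 'I_3) :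
  adjacent_distinct (a :: b :: w) ->
  decode 0 1 (code (a :: b :: w)) = map (rename a b) (a :: b :: w).
Proof.
move=> adj; have ab : a != b by case/andP: adj.
rewrite -(decode_code ab adj).
by rewrite /rename !eqxx eq_sym (negbTE ab).
Qed.

Lemma length_square_free_factor l u v :
  length_square_free l (u ++ v) ->
  length_square_free l u /\ length_square_free l v.
Proof.
move=> sf; split=> x y z E.
  by apply: (sf x y (z ++ v)); rewrite E -!catA.
by apply: (sf (u ++ x) y z); rewrite E -!catA.
Qed.

Lemma length_square_free_cons l a w :
  length_square_free l w ->
  (forall y z, a :: w = y ++ y ++ z -> size y <= l -> y = [::]) ->
  length_square_free l (a :: w).
Proof.
move=> sf sq [|b x] y z E; first exact: (sq y z E).
by case: E => _; apply: sf.
Qed.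

Lemma length_square_free_adjacent l w :
  0 < l -> length_square_free l w -> adjacent_distinct w.
Proof.
move=> l0; elim: w => [//|a [//|b w] IH] sf.
have [_ {}IH'] := @length_square_free_factor l [:: a] (b :: w) sf.
rewrite /= in IH *; rewrite IH // andbT; apply/eqP => ab.
by have := sf [::] [:: a] w; rewrite /= ab => /(_ erefl l0).
Qed.

(** * Weights of codes *)

Lemma isz_eq0 x : isz x -> x = 0%num.
Proof. by case: x. Qed.

Lemma walk_leaf d c : walk Leaf d c = d.
Proof. by elim: c. Qed.

(** Weight 0 is absorbing: below a zero node [child] gives [Leaf], which inherits the 0. *)
Lemma walk_top0 t d c : top d t = 0%num -> walk t d c = 0%num.
Proof. by case: t => [|[|p] l r]; case: c => [|b c] //= d0; rewrite walk_leaf. Qed.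

Lemma walk_cat t d c r : walk t d c = 0%num -> walk t d (c ++ r) = 0%num.
Proof.
by elim: c t d => [|b c IH] t d /= w0; [apply: walk_top0|apply: IH].
Qed.

Lemma walk_default t d d' c :
  top 0 t <> 0%num -> walk t d c = walk t d' c.
Proof. by case: t => [//|v l r] _; case: c. Qed.

Lemma walk_bounded t : exists B, forall c, (walk t 0 c <= B)%num.
Proof.
suff [B HB] : exists B, forall d c, (walk t d c <= N.max d B)%num.
  by exists B => c; have := HB 0%num c; rewrite N.max_0_l.
elim: t => [|v l [Bl Hl] r [Br Hr]].
  by exists 0%num => d c; rewrite walk_leaf; lia.
exists (N.max v (N.max Bl Br)) => d [|b c] /=; first by lia.
case: v => [|p]; first by rewrite walk_leaf; lia.
by case: b; [move: (Hr (Npos p) c)|move: (Hl (Npos p) c)]; lia.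
Qed.

Lemma has_dead_suffix_cat t c r :
  has_dead_suffix t c -> has_dead_suffix t (c ++ r).
Proof.
elim: c => [|b c IH].
  rewrite /= orbF => h; case: r => [|b r] /=; first by rewrite h.
  case E: (top 0 t) h => // _.
  by rewrite (@walk_top0 (child b t)) //; case: (t) E => [|[] ? ?].
move=> /= /orP[h|/IH->]; last by rewrite orbT.
by case E: (walk _ _ c) h => // _; rewrite walk_cat.
Qed.

Lemma has_dead_suffix_prepend t p c :
  has_dead_suffix t c -> has_dead_suffix t (p ++ c).
Proof. by move=> h; elim: p => [//|b p IH] /=; rewrite IH orbT. Qed.

(** Where [t] is a leaf, the test makes [s0] and [s1] leaves too; all three weights are then
    inherited, and the relation between them was tested at the parent. *)
Lemma check_relP (rel : N -> N -> N -> bool) t s0 s1 d d0 d1 c :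
  (d <> 0%num -> rel d d0 d1) -> check_rel rel t s0 s1 d0 d1 ->
  walk t d c <> 0%num -> rel (walk t d c) (walk s0 d0 c) (walk s1 d1 c).
Proof.
elim: t s0 s1 d d0 d1 c => [|v l IHl r IHr] s0 s1 d d0 d1 c reld /=.
  by case: s0 s1 => [|? ? ?] [|? ? ?] //= _; rewrite !walk_leaf.
case: v => [|p]; first by rewrite walk_top0.
case: ifP => // relv; case: ifP => // chl chr.
case: c => [//|b c] /=.
by case: b; [apply: IHr|apply: IHl].
Qed.

Lemma check_stepP (rel : N -> N -> N -> bool) t c :
  check_step rel t -> walk t 0 c <> 0%num ->
  rel (walk t 0 c) (walk t 0 (false :: c)) (walk t 0 (true :: c)).
Proof. by move=> chk; apply: check_relP. Qed.

(** As the default is not 0, weight 0 can only come from a zero node on the path; [s] holds the path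
    already followed, in reverse. *)
Lemma check_deadP l t s d c :
  d <> 0%num -> check_dead l t s -> walk t d c = 0%num ->
  exists2 p, half_square l (decode 0 1 (rev s ++ p)) & exists r, c = p ++ r.
Proof.
elim: t s d c => [|v t0 IH0 t1 IH1] s d c d0 /=.
  by rewrite walk_leaf.
case: v => [|v].
  by move=> h _; exists [::]; [rewrite cats0|exists c].
case/andP=> h0 h1; case: c => [//|b c] /= w0.
have [p hp [r ->]] : exists2 p, half_square l (decode 0 1 (rev (b :: s) ++ p))
    & exists r, c = p ++ r.
  by case: b w0 => w0; [apply: (IH1 _ _ _ _ h1 w0)|apply: (IH0 _ _ _ _ h0 w0)].
by exists (b :: p); [rewrite rev_cons cat_rcons in hp|exists r].
Qed.

Lemma check_squaresP t n c p :
  check_squares t n c -> size p <= n -> ~~ has_dead_suffix t (p ++ c) ->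
  square_dead t (p ++ c).
Proof.
elim: n c p => [|n IH] c p; rewrite /= => /andP[sq ext].
  by case: p.
case/lastP: p => [//|p b]; rewrite size_rcons ltnS cat_rcons => sz nd.
move: ext => /andP[ext0 ext1].
have ext : if isz (walk t 0 (b :: c)) then true else check_squares t n (b :: c).
  by case: b nd => _; [apply: ext1|apply: ext0].
case: ifP ext => [wz _|_ /IH]; last exact.
by rewrite has_dead_suffix_prepend // [has_dead_suffix _ _]/= wz in nd.
Qed.

(** * Weighted counts of words *)

Lemma sum_tuple_cons (T : finType) n (P : pred (seq T)) (F : seq T -> nat) :
  \sum_(w : n.+1.-tuple T | P w) F w =
  \sum_(w : n.-tuple T) \sum_(a | P (a :: w)) F (a :: w).
Proof.
rewrite pair_big_dep /=.
rewrite (reindex (fun p : n.-tuple T * T => [tuple of p.2 :: p.1])) //=.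
exists (fun w : n.+1.-tuple T => ([tuple of behead w], thead w)) => [[w a] _|w _] /=.
  by congr pair; apply/val_inj.
by rewrite [RHS]tuple_eta; apply/val_inj.
Qed.

(** The letters allowed in front of [b], [c] are [c], with bit [false], and the third letter, with
    bit [true]. *)
Lemma sum_letters (b c : 'I_3) (G : bool -> nat) : b != c ->
  \sum_(a : 'I_3 | a != b) G (a != c) = G false + G true.
Proof.
move=> bc; rewrite (bigD1 c) 1?eq_sym //= eqxx; congr addn.
rewrite (eq_bigr (fun=> G true)); last by move=> a /andP[_ ->].
have [d Hd] : exists d : 'I_3, forall a, (a != b) && (a != c) = (a == d).
  have k : 3 - b - c < 3 by move: {G} b c bc; do 2![case; case=> [|[|[|?]]] //= ?].
  exists (Ordinal k) => a; move: {G} b c a bc k.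
  by do 3![case; case=> [|[|[|?]]] //= ?].
by rewrite (eq_bigl (pred1 d)) // big_pred1_eq.
Qed.

Definition weight (t : tree) (w : word) : nat := N.to_nat (walk t 0 (code w)).

Definition total_weight (t : tree) (P : pred word) (n : nat) : nat :=
  \sum_(w : n.-tuple 'I_3 | P w) weight t w.

Lemma sum_weight (t : tree) (b c : 'I_3) (w : word) : b != c ->
  \sum_(a | a != b) weight t (a :: b :: c :: w) =
  N.to_nat (walk t 0 (false :: code (b :: c :: w)))
  + N.to_nat (walk t 0 (true :: code (b :: c :: w))).
Proof.
move=> bc.
exact: (sum_letters (fun x => N.to_nat (walk t 0 (x :: code (b :: c :: w)))) bc).
Qed.

(** The extensions of a word that stay in [P] are among its two extensions without repeated letter,
    so the relation can be summed over words. Lengths start at 2, where each new letter adds one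
    bit. *)
Lemma total_weight_upper t (P : pred word) (K M : nat) :
  (forall a w, P (a :: w) -> P w) -> (forall w, P w -> adjacent_distinct w) ->
  (forall c, walk t 0 c <> 0%num ->
     K * (N.to_nat (walk t 0 (false :: c)) + N.to_nat (walk t 0 (true :: c)))
     <= M * N.to_nat (walk t 0 c)) ->
  (forall w, 1 < size w -> P w -> walk t 0 (code w) <> 0%num) ->
  forall n, K ^ n * total_weight t P n.+2 <= M ^ n * total_weight t P 2.
Proof.
move=> Pb Pa rel Pw; elim=> [|n IH]; first by rewrite !expn0 !mul1n.
rewrite !expnSr -mulnA [X in _ <= X]mulnAC.
apply: (@leq_trans (K ^ n * (total_weight t P n.+2 * M))); last first.
  by rewrite mulnA leq_mul2r IH orbT.
rewrite leq_mul2l; apply/orP; right.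
rewrite /total_weight sum_tuple_cons big_distrr big_distrl /=.
rewrite [X in _ <= X]big_mkcond /=; apply: leq_sum => w _.
case: ifP => [Pw'|nPw]; last first.
  by rewrite big_pred0 ?muln0 // => a; apply: contraFF nPw; apply: Pb.
case: w Pw' => [[|b [|c w]] //= sz] Pw'.
have bc : b != c by case/andP: (Pa _ Pw').
rewrite [X in _ <= X]mulnC.
apply: leq_trans (rel _ (Pw _ _ Pw')) => //.
rewrite leq_mul2l; apply/orP; right; rewrite -sum_weight //.
rewrite [X in X <= _]big_mkcond [X in _ <= X]big_mkcond; apply: leq_sum => a _.
by case: ifP => // Pabc; case/andP: (Pa _ Pabc) => ->.
Qed.

(** An extension that leaves [P] without repeating a letter has weight 0, so leaving it out does not
    lower the sum. *)
Lemma total_weight_lower t (P : pred word) (K M : nat) :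
  (forall a w, P (a :: w) -> P w) -> (forall w, P w -> adjacent_distinct w) ->
  (forall c, walk t 0 c <> 0%num ->
     M * N.to_nat (walk t 0 c) <=
     K * (N.to_nat (walk t 0 (false :: c)) + N.to_nat (walk t 0 (true :: c)))) ->
  (forall a w, P w -> adjacent_distinct (a :: w) ->
     walk t 0 (code (a :: w)) <> 0%num -> P (a :: w)) ->
  forall n, M ^ n * total_weight t P 2 <= K ^ n * total_weight t P n.+2.
Proof.
move=> Pb Pa rel Pw; elim=> [|n IH]; first by rewrite !expn0 !mul1n.
rewrite !expnSr mulnAC -[X in _ <= X]mulnA.
apply: (@leq_trans (K ^ n * (total_weight t P n.+2 * M))).
  by rewrite mulnA leq_mul2r IH orbT.
rewrite leq_mul2l; apply/orP; right.
rewrite /total_weight [X in _ <= K * X]sum_tuple_cons big_distrr big_distrl /=.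
rewrite [X in X <= _]big_mkcond /=; apply: leq_sum => w _.
case: ifP => // Pw'.
case: w Pw' => [[|b [|c w]] //= sz] Pw'.
have adj := Pa _ Pw'; have bc : b != c by case/andP: adj.
rewrite [X in X <= _]mulnC.
case: (eqVneq (walk t 0 (code (b :: c :: w))) 0%num) => [w0|/eqP wn0].
  by rewrite /weight w0 muln0.
apply: leq_trans (rel _ wn0) _.
rewrite leq_mul2l; apply/orP; right; rewrite -sum_weight //.
rewrite [X in X <= _]big_mkcond [X in _ <= X]big_mkcond; apply: leq_sum => a _.
case: ifP => // ab; case: ifP => // nP.
case: (eqVneq (walk t 0 (code (a :: b :: c :: w))) 0%num) => [w0|/eqP wn0'].
  by rewrite /weight w0.
by rewrite (Pw a) // in nP; rewrite /= ab.
Qed.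

Lemma nb_length_square_freeE l n :
  nb_length_square_free l n =
  \sum_(w : n.-tuple 'I_3 | `[< length_square_free l w >]) 1.
Proof. by rewrite /nb_length_square_free cardsE sum1_card. Qed.

Lemma half_square_map (f : 'I_3 -> nat) l w u z : injective f ->
  map f w = u ++ z -> half_square l u ->
  exists y z', [/\ w = y ++ y ++ z', size y <= l & y <> [::]].
Proof.
move=> inj_f E /andP[/andP[h0 hl] /eqP Eh].
set h := (size u)./2 in h0 hl Eh.
(* [h] is half the length rounded down; equality of the two parts excludes odd lengths. *)
have su : size u = h + h.
  have := congr1 size Eh; rewrite size_take_min size_drop.
  have : h <= size u by rewrite /h -{2}(odd_double_half (size u)) -addnn addnA leq_addl.
  by move=> le; rewrite (minn_idPl le) => eq; rewrite {2}eq subnKC.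
have suw : size u <= size w.
  by have := congr1 size E; rewrite size_map size_cat => ->; rewrite leq_addr.
have Eu : u = map f (take (size u) w).
  by rewrite map_take E take_size_cat.
have sy : size (take h w) = h.
  by rewrite size_takel // (leq_trans _ suw) // su leq_addr.
exists (take h w), (drop (size u) w); split; last 2 first.
- by rewrite sy.
- by move=> y0; rewrite y0 /= in sy; rewrite -sy in h0.
rewrite -{1}(cat_take_drop (size u) w) catA; congr (_ ++ _).
rewrite -{1}(cat_take_drop h (take (size u) w)) take_takel ?su ?leq_addr //.
congr (_ ++ _); apply: (inj_map inj_f).
rewrite -su map_drop -Eu -Eh {1}Eu -map_take take_takel ?su ?leq_addr //.
Qed.

Lemma good_weight l t (w : word) : 0 < l ->
  ~~ isz (top 0 t) -> check_dead l t [::] ->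
  1 < size w -> length_square_free l w -> walk t 0 (code w) <> 0%num.
Proof.
move=> l0 t0 dead sw sf w0.
have adj := length_square_free_adjacent l0 sf.
case: w sw sf adj w0 => [|a [|b w]] // _ sf adj w0.
have ab : a != b by case/andP: adj.
(* With default 1, weight 0 must come from a zero node, hence from a square. *)
rewrite (@walk_default t 0 1) in w0; last by case: (top 0 t) t0.
have [//|p hp [r Er]] := check_deadP _ dead w0.
have [z Ez] := decode_cat 0 1 p r.
rewrite -Er (decode_code01 adj) in Ez.
have [y [z' [E sy y0]]] := half_square_map (rename_inj ab) Ez hp.
exact: y0 (sf [::] y z' E sy).
Qed.

(** Each word counted has a positive integral weight, so the count is at most the total weight. *)
Lemma count_upper l K k t : 0 < l -> check_upper l K k t ->
  exists C, forall n,
    N.to_nat K ^ n * nb_length_square_free l n.+2 <= C * N.to_nat (2 ^ k) ^ n.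
Proof.
move=> l0 /and3P[t0 step dead].
pose P := fun w : word => `[< length_square_free l w >].
exists (total_weight t P 2) => n.
have sfw w : 1 < size w -> P w -> walk t 0 (code w) <> 0%num.
  by move=> sw /asboolP; apply: good_weight.
rewrite [X in _ <= X]mulnC.
apply: leq_trans; last first.
  apply: (@total_weight_upper t P (N.to_nat K) _ _ _ _ sfw).
  - move=> a w /asboolP sf; apply/asboolP.
    by case: (@length_square_free_factor l [:: a] w sf).
  - by move=> w /asboolP; apply: length_square_free_adjacent.
  move=> c wc; have := check_stepP step wc.
  rewrite /upper_rel N.shiftl_mul_pow2 => /N.leb_le.
  move=> le; apply/leP; rewrite -plusE -!multE -N2Nat.inj_add -!N2Nat.inj_mul; lia.
rewrite leq_mul2l; apply/orP; right.
rewrite nb_length_square_freeE; apply: leq_sum => w Pw.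
rewrite /weight; have := sfw w; rewrite size_tuple => /(_ erefl Pw).
by case: (walk _ _ _) => // p _; rewrite /= ; apply/leP; lia.
Qed.

Definition live t (w : word) : bool :=
  adjacent_distinct w && ~~ has_dead_suffix t (code w).

Lemma live_cons t a w : live t (a :: w) -> live t w.
Proof.
case: w => [//|b [|c w]]; rewrite /live => /andP[/andP[_ adj] nd].
  exact: nd.
apply/andP; split; first exact: adj.
by apply: contra nd => nd; apply: (@has_dead_suffix_prepend t [:: a != c]).
Qed.

Lemma live_cat t u v : live t (u ++ v) -> live t u.
Proof.
case/andP=> adj nd; apply/andP; split; last first.
  have [r E] := code_cat u v; apply: contra nd; rewrite E.
  exact: has_dead_suffix_cat.
elim: u adj {nd} => [//|a [//|b u] IH] /= /andP[->]; exact: IH.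
Qed.

Lemma adjacent_distinct_last (T : eqType) (c a : T) y z :
  adjacent_distinct (c :: y ++ a :: z) -> last c y != a.
Proof. by elim: y c => [|b y IH] c /= /andP[ca //]; apply: IH. Qed.

(** If a live word starts with yy, then y and yy are live; the code of y has at most l - 2 bits, so
    the test covers it and contradicts one of the two. *)
Lemma live_square_free l t w :
  check_squares t l.-2 [::] -> live t w -> length_square_free l w.
Proof.
move=> sq; elim: w => [|a w IH] lw; first by case=> [|? ?] [|? ?].
apply: length_square_free_cons (IH (live_cons lw)) _ => y z E sy.
case: y sy E => [//|a' [|b y]] sy E; rewrite E in lw.
  by case/andP: lw => /= /andP[/eqP].
exfalso; have adjsq := proj1 (andP lw).
have ly : live t (a' :: b :: y) := live_cat lw.
have /andP[adj ndy] := ly.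
have ab : a' != b by case/andP: adj.
have sc : size (code (a' :: b :: y)) <= l.-2.
  have sz (T : eqType) (u : seq T) : size (code u) = (size u).-2.
    by elim: u => [//|x [//|x' [//|x'' u]] IHu]; rewrite /= in IHu *; rewrite IHu.
  by rewrite sz /=; case: (l) sy => [//|[|m]].
have := check_squaresP sq sc; rewrite cats0 => /(_ ndy).
rewrite /square_dead (decode_code01 adj) => /orP[].
  (* First alternative: y ends in its first letter, which repeats a letter where the two copies of y
     meet. *)
  have /= la := @adjacent_distinct_last _ a' a' (b :: y) (b :: y ++ z) adjsq.
  rewrite /= last_map {1}/rename (negbTE la).
  by case: ifP.
rewrite -map_cat (code_map _ (rename_inj ab)).
rewrite catA in lw; have /andP[_ /negP] := live_cat lw; exact.
Qed.

(** Live words are among those counted and weights are bounded, so the total weight of live words is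
    at most a constant times the count. *)
Lemma count_lower l K k t : check_lower l K k t ->
  exists2 B, 0 < B & forall n,
    N.to_nat (2 ^ k) ^ n <= B * (N.to_nat K ^ n * nb_length_square_free l n.+2).
Proof.
move=> /and3P[t0 step sq].
have [B HB] := walk_bounded t.
exists (N.to_nat B).+1 => // n.
(* A word of two distinct letters has the empty code, whose weight is that of the root. *)
have pos : 0 < total_weight t (live t) 2.
  have P01 : live t [:: ord0; ord_max].
    by rewrite /live /= orbF.
  rewrite /total_weight (bigD1 [tuple of [:: ord0; ord_max]]) //=.
  apply: ltn_addr; rewrite /weight /=.
  by case: (top 0 t) t0 => // p _ /=; apply/ltP; lia.
apply: (@leq_trans (N.to_nat K ^ n * total_weight t (live t) n.+2)).
  apply: (@leq_trans (N.to_nat (2 ^ k) ^ n * total_weight t (live t) 2)).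
    by rewrite leq_pmulr.
  apply: total_weight_lower => [a w|w /andP[]//|c wc|a w lw adj wn0].
  - exact: live_cons.
  - have := check_stepP step wc.
    rewrite /lower_rel N.shiftl_mul_pow2 => /N.leb_le le.
    by apply/leP; rewrite -plusE -!multE -N2Nat.inj_add -!N2Nat.inj_mul; lia.
  apply/andP; split=> //; case/andP: lw => _ nd.
  case: w wn0 nd {adj} => [|b [|c w]] wn0 nd; [exact: nd|exact: nd|].
  rewrite [code _]/= in wn0 *; rewrite [has_dead_suffix _ _]/= negb_or.
  apply/andP; split; last exact: nd.
  by apply/negP => /isz_eq0.
rewrite mulnCA leq_mul2l; apply/orP; right.
rewrite nb_length_square_freeE big_distrr /= /total_weight.
rewrite big_mkcond [X in _ <= X]big_mkcond; apply: leq_sum => w _.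
case: ifP => // lw; rewrite asboolT; last exact: live_square_free lw.
rewrite muln1.
apply/leP; rewrite /weight; move: (walk _ _ _) (HB (code w)) => x; lia.
Qed.

(** * Growth rates *)

Lemma nb_square_free_add m n :
  nb_square_free (m + n) <= nb_square_free m * nb_square_free n.
Proof.
rewrite /nb_square_free -cardsX.
set A := [set _ | _]; set B := setX _ _.
pose f (p : m.-tuple 'I_3 * n.-tuple 'I_3) := [tuple of p.1 ++ p.2].
apply: leq_trans (leq_imset_card f B); apply/subset_leq_card/subsetP => w.
rewrite inE => /asboolP sf.
have sm : size (take m w) == m by rewrite size_takel // size_tuple leq_addr.
have sn : size (drop m w) == n by rewrite size_drop size_tuple addKn.
apply/imsetP; exists (Tuple sm, Tuple sn); last first.
  by apply/val_inj; rewrite /= cat_take_drop.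
rewrite !inE /=; apply/andP; split; apply/asboolP => x y z E.
  by apply: (sf x y (z ++ drop m w)); rewrite -[LHS](cat_take_drop m) E -!catA.
by apply: (sf (take m w ++ x) y z); rewrite -[LHS](cat_take_drop m) E -!catA.
Qed.

Lemma nb_square_free_le l n : nb_square_free n <= nb_length_square_free l n.
Proof.
apply/subset_leq_card/subsetP => w; rewrite !inE => /asboolP sf.
by apply/asboolP => x y z E _; apply: sf E.
Qed.

Lemma INR_N_to_nat (x : N) : INR (N.to_nat x) = IZR (Z.of_N x).
Proof. by rewrite INR_IZR_INZ N_nat_Z. Qed.

Lemma INR_expn (x n : nat) : INR (x ^ n) = (INR x ^ n)%R.
Proof.
by elim: n => [|n IH]; rewrite ?expn0 // expnS -multE mult_INR IH.
Qed.

Local Open Scope R_scope.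

(** The limit is the infimum of u n / n. Dividing n by some m + 1 whose quotient is nearly minimal
    bounds u n by n times that quotient, plus a constant [C] for the remainders. *)
Lemma fekete (u : nat -> R) :
  (forall m n, u (m + n)%nat <= u m + u n) -> (forall n, 0 <= u n) ->
  exists L : R, is_lim_seq (fun n => u n / INR n) L.
Proof.
move=> sub pos.
have [lb glb] := Glb_Rbar_correct (fun x => exists n, x = u n.+1 / INR n.+1).
set L := Glb_Rbar _ in lb glb.
have L0 : Rbar_le 0 L.
  by apply: glb => _ [n ->]; apply: Rdiv_le_0_compat => //; apply: lt_0_INR; lia.
have L1 := lb _ (ex_intro _ 0%nat erefl).
case: L lb glb L0 L1 => [L| |] //= lb glb _ _.
exists L; apply/is_lim_seq_spec => eps.
have [m Hm] : exists m, u m.+1 / INR m.+1 < L + eps / 2.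
  apply: contrapT => H.
  have : L + eps / 2 <= L.
    apply: (glb (Rbar.Finite (L + eps / 2))) => _ [n ->] /=.
    by apply: Rnot_lt_le => h; apply: H; exists n.
  by have := cond_pos eps; lra.
have [C HC] : exists C, forall r, (r < m.+1)%coq_nat -> u r <= C.
  elim: m.+1 => [|k [C HC]]; first by exists 0 => r; lia.
  exists (Rmax C (u k)) => r rk.
  case: (Nat.eq_dec r k) => [->|ne]; first exact: Rmax_r.
  by apply: Rle_trans (Rmax_l _ _); apply: HC; lia.
have m0 : 0 < INR m.+1 by apply: lt_0_INR; lia.
have mult q r : u (q * m.+1 + r)%nat <= INR q * u m.+1 + u r.
  elim: q => [|q IH]; first by rewrite mul0n add0n /=; lra.
  rewrite mulSn -addnA S_INR.
  by have := sub m.+1 (q * m.+1 + r)%nat; lra.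
have bound n : u n <= INR n * (u m.+1 / INR m.+1) + C.
  rewrite {1}(divn_eq n m.+1).
  have hq := mult (n %/ m.+1)%nat (n %% m.+1)%nat.
  have hr : u (n %% m.+1)%nat <= C by apply: HC; apply/ltP; rewrite ltn_mod.
  have hn : INR (n %/ m.+1) * INR m.+1 <= INR n.
    by rewrite -mult_INR; apply: le_INR; apply/leP; apply: leq_trunc_div.
  (* Replacing q (m + 1) by the larger n uses that u is nonnegative. *)
  have : INR (n %/ m.+1) * u m.+1 <= INR n * (u m.+1 / INR m.+1).
    have -> : INR (n %/ m.+1) * u m.+1
        = (INR (n %/ m.+1) * INR m.+1) * (u m.+1 / INR m.+1) by field; lra.
    apply: Rmult_le_compat_r hn.
    by apply: Rdiv_le_0_compat.
  lra.
have [N HN] := nfloor_ex (Rmax 0 (2 * C / eps)) (Rmax_l _ _).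
exists N.+1 => n nN.
have n0 : 0 < INR n by apply: lt_0_INR; lia.
have e0 := cond_pos eps.
have lo : L <= u n / INR n.
  by case: n nN n0 => [|n] nN n0; [lia|apply: (lb _ (ex_intro _ n erefl))].
have hi : u n / INR n <= u m.+1 / INR m.+1 + C / INR n.
  apply: (Rmult_le_reg_r (INR n)) => //.
  have -> : u n / INR n * INR n = u n by field; lra.
  have -> : (u m.+1 / INR m.+1 + C / INR n) * INR n
    = INR n * (u m.+1 / INR m.+1) + C by field; lra.
  exact: bound.
have : C / INR n < eps / 2.
  apply: (Rmult_lt_reg_r (INR n)) => //.
  have -> : C / INR n * INR n = C by field; lra.
  have : 2 * C / eps < INR n.
    apply: Rle_lt_trans (Rmax_r 0 _) _; apply: Rlt_le_trans (proj2 HN) _.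
    by rewrite -S_INR; apply: le_INR.
  move=> /(Rmult_lt_compat_r (eps / 2)) h.
  have -> : eps / 2 * INR n = INR n * (eps / 2) by ring.
  have {1}-> : C = 2 * C / eps * (eps / 2) by field; lra.
  by apply: h; lra.
move=> hC; apply: Rabs_def1; lra.
Qed.

Lemma ln0 : ln 0 = 0.
Proof.
by rewrite /ln; case: (Rlt_dec 0 0) => [h|//]; case: (Rlt_irrefl 0 h).
Qed.

Lemma entropy_seq_cvg : exists L : R, is_lim_seq entropy_seq L.
Proof.
case: (EM (exists n, nb_square_free n = 0%nat)) => [[N HN]|H].
  (* By submultiplicativity, the counts vanish from [N] on. *)
  exists 0; apply: (is_lim_seq_ext_loc (fun=> 0)); last exact: is_lim_seq_const.
  exists N => n Nn; rewrite /entropy_seq.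
  have -> : nb_square_free n = 0%nat.
    have := nb_square_free_add N (n - N)%nat.
    rewrite HN mul0n leqn0 subnKC; last exact/leP.
    by move/eqP.
  by rewrite ln0 /Rdiv Rmult_0_l.
have pos n : 1 <= INR (nb_square_free n).
  rewrite -INR_1; apply: le_INR.
  by case E: (nb_square_free n) => [|k]; [case: H; exists n|lia].
apply: fekete => [m n|n]; last first.
  by rewrite -ln_1; apply: ln_le => //; lra.
rewrite -ln_mult; try by apply: Rlt_le_trans (pos _); lra.
apply: ln_le; first by apply: Rlt_le_trans (pos _); lra.
by rewrite -mult_INR; apply: le_INR; apply/leP; apply: nb_square_free_add.
Qed.

Lemma is_lim_entropy : is_lim_seq entropy_seq entropy.
Proof.
have [L HL] := entropy_seq_cvg.
by rewrite /entropy (is_lim_seq_unique _ _ HL).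
Qed.

(** Taking logarithms gives ln s_n / n <= ln C / n - ln r; then n tends to infinity. *)
Lemma entropy_le (r B : R) : 0 < r <= 1 ->
  (forall n, INR (nb_square_free n) * r ^ n <= B) -> entropy <= - ln r.
Proof.
move=> [r0 r1] HB.
have lnr : ln r <= 0 by rewrite -ln_1; apply: ln_le.
pose C := Rmax 1 B.
have C1 : 1 <= C := Rmax_l _ _.
have lnC : 0 <= ln C by rewrite -ln_1; apply: ln_le; lra.
have lim : is_lim_seq (fun n => ln C * / INR n - ln r) (ln C * 0 - ln r).
  apply: is_lim_seq_minus'; last exact: is_lim_seq_const.
  apply: is_lim_seq_mult'; first exact: is_lim_seq_const.
  by apply: (is_lim_seq_inv _ _ is_lim_seq_INR).
have -> : - ln r = ln C * 0 - ln r by ring.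
apply: (is_lim_seq_le_loc _ _ (Rbar.Finite _) (Rbar.Finite _) _ is_lim_entropy lim).
exists 1%nat => n n1.
have n0 : 0 < INR n by apply: lt_0_INR; lia.
rewrite /entropy_seq; apply: (Rmult_le_reg_r (INR n)) => //.
have -> : (ln C * / INR n - ln r) * INR n = ln C - INR n * ln r by field; lra.
have -> : ln (INR (nb_square_free n)) / INR n * INR n
  = ln (INR (nb_square_free n)) by field; lra.
have nr : INR n * ln r <= 0.
  by have := Rmult_le_compat_l (INR n) _ _ (Rlt_le _ _ n0) lnr; lra.
(* When the count is 0, its logarithm is 0 by convention; the right side is nonnegative because C >=
   1 and r <= 1. *)
case: (Nat.eq_dec (nb_square_free n) 0) => [->|s0]; first by rewrite ln0; lra.
have sn : 0 < INR (nb_square_free n) by apply: lt_0_INR; lia.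
suff : ln (INR (nb_square_free n)) + INR n * ln r <= ln C by lra.
have rn : 0 < r ^ n by apply: pow_lt.
rewrite -ln_pow // -ln_mult //; apply: ln_le; first exact: Rmult_lt_0_compat.
by apply: Rle_trans (HB n) (Rmax_r _ _).
Qed.

(** The radius of convergence is the supremum of these [r]; the coefficients are nonnegative, so no
    absolute value is needed. *)
Definition bounded_at (l : nat) (r : R) : Prop :=
  0 < r /\ exists B : R, forall n, INR (nb_length_square_free l n) * r ^ n <= B.

(** The bounds [lo] and [hi] exclude an infinite radius, which [real] would turn into 0. *)
Lemma radius_lub l lo hi :
  bounded_at l lo -> (forall r, bounded_at l r -> r <= hi) ->
  lo <= radius l /\ forall b, (forall r, bounded_at l r -> r <= b) -> radius l <= b.
Proof.
move=> [lo0 [B HB]] Hhi; rewrite /radius.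
have abs r n : 0 < r -> Rabs (INR (nb_length_square_free l n) * r ^ n)
    = INR (nb_length_square_free l n) * r ^ n.
  move=> r0; apply: Rabs_pos_eq; apply: Rmult_le_pos; first exact: pos_INR.
  by apply: pow_le; lra.
have [ub lub] := CV_radius_bounded (fun n => INR (nb_length_square_free l n)).
have lub' b : 0 <= b -> (forall r, bounded_at l r -> r <= b) ->
    Rbar_le (CV_radius (fun n => INR (nb_length_square_free l n))) b.
  move=> b0 Hb; apply: lub => r [M HM] /=.
  case: (Rle_lt_dec r 0) => [r0|r0]; first by lra.
  by apply: Hb; split=> //; exists M => n; rewrite -abs.
have h0 : 0 <= hi.
  by apply: Rle_trans (Rlt_le _ _ lo0) _; apply: Hhi; split=> //; exists B.
have lo_le : Rbar_le lo (CV_radius (fun n => INR (nb_length_square_free l n))).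
  by apply: ub; exists B => n; rewrite abs.
have hi_le := lub' _ h0 Hhi.
case: (CV_radius _) lub' lo_le hi_le => [x| |] //= lub' lo_le _.
split=> // b Hb; apply: lub' => //.
by apply: Rle_trans (Rlt_le _ _ lo0) _; apply: Hb; split=> //; exists B.
Qed.

Lemma bounded_at_ratio l (K M C : nat) : (0 < K)%N -> (0 < M)%N ->
  (forall n, (K ^ n * nb_length_square_free l n.+2 <= C * M ^ n)%N) ->
  bounded_at l (INR K / INR M).
Proof.
move=> K0 M0 HC.
have k0 : 0 < INR K by apply: lt_0_INR; apply/ltP.
have m0 : 0 < INR M by apply: lt_0_INR; apply/ltP.
set r := INR K / INR M; have r0 : 0 < r by apply: Rdiv_lt_0_compat.
split=> //.
set a := fun n => INR (nb_length_square_free l n).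
have a0 n : 0 <= a n by apply: pos_INR.
(* The hypothesis starts at length 2, so the first two terms enter the bound separately. *)
exists (a 0%N + a 1%N * r + INR C * r ^ 2).
have r2 : 0 <= r ^ 2 by apply: pow_le; lra.
have t1 : 0 <= a 1%N * r by apply: Rmult_le_pos => //; lra.
have t2 : 0 <= INR C * r ^ 2 by apply: Rmult_le_pos => //; apply: pos_INR.
have a00 := a0 0%N.
case=> [|[|n]]; [by rewrite -/(a _) /=; lra|by rewrite -/(a _) /=; lra|].
rewrite -/(a _); suff : a n.+2 * r ^ n.+2 <= INR C * r ^ 2 by lra.
have -> : a n.+2 * r ^ n.+2 = a n.+2 * r ^ n * r ^ 2 by rewrite /=; ring.
apply: Rmult_le_compat_r => //.
have mn : 0 < INR M ^ n by apply: pow_lt.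
have := HC n => /leP /le_INR; rewrite -!multE !mult_INR !INR_expn -/(a _) => h.
apply: (Rmult_le_reg_r (INR M ^ n)) => //.
rewrite Rmult_assoc -Rpow_mult_distr /r.
have -> : INR K / INR M * INR M = INR K by field; lra.
by lra.
Qed.

(** If r exceeded K / M, the powers of q = r M / K > 1 would stay below B C / r^2. *)
Lemma bounded_at_le_ratio l (K M B : nat) (r : R) : (0 < K)%N -> (0 < M)%N ->
  (forall n, (M ^ n <= B * (K ^ n * nb_length_square_free l n.+2))%N) ->
  bounded_at l r -> r <= INR K / INR M.
Proof.
move=> K0 M0 HB [r0 [C HC]].
have k0 : 0 < INR K by apply: lt_0_INR; apply/ltP.
have m0 : 0 < INR M by apply: lt_0_INR; apply/ltP.
apply: Rnot_lt_le => lt.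
pose q := r * INR M / INR K.
have q1 : 1 < q.
  apply: (Rmult_lt_reg_r (INR K)) => //.
  have -> : q * INR K = r * INR M by rewrite /q; field; lra.
  have := Rmult_lt_compat_r (INR M) _ _ m0 lt.
  have -> : INR K / INR M * INR M = INR K by field; lra.
  by lra.
have r2 : 0 < r ^ 2 by apply: pow_lt.
have [|N HN] := Pow_x_infinity q _ (INR B * C / r ^ 2 + 1).
  by rewrite Rabs_pos_eq; lra.
have := HN N (Nat.le_refl N).
rewrite Rabs_pos_eq; last by apply: pow_le; lra.
suff : q ^ N <= INR B * C / r ^ 2 by lra.
have kn : 0 < INR K ^ N by apply: pow_lt.
apply: (Rmult_le_reg_r (r ^ 2 * INR K ^ N)); first exact: Rmult_lt_0_compat.
have -> : INR B * C / r ^ 2 * (r ^ 2 * INR K ^ N) = INR B * (C * INR K ^ N).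
  by field; lra.
have -> : q ^ N * (r ^ 2 * INR K ^ N) = INR M ^ N * r ^ N.+2.
  have -> : q ^ N * (r ^ 2 * INR K ^ N) = (q * INR K) ^ N * r ^ 2.
    by rewrite Rpow_mult_distr; ring.
  have -> : q * INR K = INR M * r by rewrite /q; field; lra.
  by rewrite Rpow_mult_distr /=; ring.
have := HB N => /leP /le_INR; rewrite -!multE !mult_INR !INR_expn => h.
have rn : 0 <= r ^ N.+2 by apply: pow_le; lra.
apply: Rle_trans (Rmult_le_compat_r _ _ _ rn h) _.
have := Rmult_le_compat_l (INR B * INR K ^ N) _ _ _ (HC N.+2) => h'.
have : 0 <= INR B * INR K ^ N by apply: Rmult_le_pos; [apply: pos_INR|lra].
by move=> /h'; lra.
Qed.

Lemma bounded_at_upper l K k t : (0 < l)%N -> (0 < K)%num ->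
  check_upper l K k t -> bounded_at l (IZR (Z.of_N K) / IZR (Z.of_N (2 ^ k))).
Proof.
move=> l0 K0 /(count_upper l0)[C HC].
rewrite -!INR_N_to_nat; apply: bounded_at_ratio HC; apply/ltP; first by lia.
by have := N.pow_nonzero 2 k; lia.
Qed.

Lemma bounded_at_lower l K k t r : (0 < K)%num -> check_lower l K k t ->
  bounded_at l r -> r <= IZR (Z.of_N K) / IZR (Z.of_N (2 ^ k)).
Proof.
move=> K0 /count_lower[B _ HB].
rewrite -!INR_N_to_nat; apply: bounded_at_le_ratio HB; apply/ltP; first by lia.
by have := N.pow_nonzero 2 k; lia.
Qed.

Lemma radius24_bounds :
  12886339 / 16777216 <= radius 24 <= 52782444609 / 68719476736 /\
  entropy <= - ln (radius 24).
Proof.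
have lo : bounded_at 24 (12886339 / 16777216) :=
  @bounded_at_upper 24 12886339 24 _ isT erefl upper_tree_checked.
have hi r : bounded_at 24 r -> r <= 52782444609 / 68719476736 :=
  @bounded_at_lower 24 52782444609 36 _ r erefl lower_tree_checked.
have [ge lub] := radius_lub lo hi.
have le := lub _ hi.
split; first by split; lra.
have r0 : 0 < radius 24 by lra.
(* In exponential form the claim is an upper bound on the radius, which need only be checked at each
   admissible r. *)
suff : radius 24 <= exp (- entropy).
  by move=> h; have := ln_le _ _ r0 h; rewrite ln_exp; lra.
apply: lub => r br; have [rp [B HB]] := br; have r1 := hi r br.
have h : entropy <= - ln r.
  apply: (@entropy_le r B) => [|n]; first by lra.
  apply: Rle_trans (HB n); apply: Rmult_le_compat_r; first by apply: pow_le; lra.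
  by apply: le_INR; apply/leP; apply: nb_square_free_le.
rewrite -[X in X <= _](exp_ln _ rp).
have h' : ln r <= - entropy by lra.
by case: h' => [/exp_increasing|->]; lra.
Qed.


(* Undoes the shadowing of [Finite] by MathComp. *)
From Coquelicot Require Import Coquelicot.

Theorem theorem1 :
  is_lim_seq entropy_seq (Finite entropy) /\
  (entropy <= - ln (radius 24))%R /\
  (Rabs (radius 24 - 0.768085659) <= 5 / 10 ^ 10)%R /\
  (exp entropy <= / radius 24)%R /\
  (/ radius 24 < 1.3019382)%R.
Proof.
have [[lo hi] entropy_bound] := radius24_bounds.
have r0 : 0 < radius 24 by lra.
split; first exact: is_lim_entropy.
split; first exact: entropy_bound.
(* Both dyadic fractions lie within 5 / 10^10 of 0.768085659. *)
split; first by apply: Rabs_le; lra.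
split; last first.
  apply: (Rmult_lt_reg_l (radius 24)) => //.
  by rewrite Rinv_r; lra.
rewrite -(exp_ln _ r0) -exp_Ropp.
by case: entropy_bound => [/exp_increasing|->]; lra.
Qed.
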